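(* Let $(\mathcal M,\mathrm d)$ be a totally bounded metric space, let $(\Xi,\sigma(\Xi),\mathbf P)$ be a probability space and $\xi_1,\dots,\xi_N$ i.i.d. with law $\mathbf P$, and let $G:\mathcal M\times\Xi\to\mathbb R$ be a measurable function with $\mathbf E|G(x_0,\cdot)|<\infty$ for some $x_0\in\mathcal M$. Assume there exist a measurable $\mathsf L:\Xi\to\mathbb R_+$ with $\mathbf E\,\mathsf L^2\le\nu^2<\infty$ and a constant $0<\alpha\le1$ such that for $\mathbf P$-a.e. $\xi\in\Xi$, $$\forall x,x'\in\mathcal M:\quad |G(x,\xi)-G(x',\xi)|\le\mathsf L(\xi)\,\mathrm d(x,x')^\alpha.$$ Write $$\Delta G:=\sup_{x\in\mathcal M}\big|(\widehat{\mathbf E}-\mathbf E)(G(x,\cdot)-G(x_0,\cdot))\big|$$ and assume $\mathbb P\{\widehat{\mathbf E}\,\mathsf L^2(\cdot)>2\nu^2\}\le\rho\in[0,1]$. Then for any $t\ge0$, $$\mathbb P\left\{\widehat{\mathbf E}\,\mathsf L(\cdot)^2\le2\nu^2,\ \ \Delta G>\nu\,\frac{4\sqrt3\,\gamma_2^{(\alpha)}(\mathcal M,\mathrm d)+6\sqrt3\,\mathrm{diam}(\mathcal M)^\alpha\sqrt{1+t}}{\sqrt N}\right\}\le e^{-t}.$$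
   Context: For a function $H$ on $\Xi$, $\mathbf E H=\int H\,d\mathbf P$ and $\widehat{\mathbf E}H=\frac1N\sum_{k=1}^N H(\xi_k)$; $\mathbb P$ is the probability on the space where the $\xi_k$ are defined. Generic chaining functional: a sequence $\{\mathcal A_j\}_{j\ge0}$ of partitions of $\mathcal M$ is admissible if $|\mathcal A_0|=1$ and $|\mathcal A_j|\le2^{2^j}$ for $j\ge1$; $\mathrm{diam}(\mathcal A_j)$ is the largest diameter of a cell of $\mathcal A_j$; and $\gamma_2^{(\alpha)}(\mathcal M,\mathrm d):=\inf_{\{\mathcal A_j\}\text{ admissible}}\sum_{j\ge0}2^{j/2}\,\mathrm{diam}(\mathcal A_j)^\alpha$. *)

(* Defs.v *)
From HB Require Import structures.
From mathcomp Require Import all_boot all_order all_algebra.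
From mathcomp Require Import all_classical all_reals all_analysis measurable_realfun.

Set Implicit Arguments.
Unset Strict Implicit.
Unset Printing Implicit Defensive.

Import Order.TTheory GRing.Theory Num.Theory.
Import numFieldNormedType.Exports.

Local Open Scope classical_set_scope.
Local Open Scope ring_scope.

Definition totally_bounded_space (R : realType) (M : metricType R) : Prop :=
  forall e : R, 0 < e ->
    exists2 C : set M, finite_set C & setT = \bigcup_(c in C) ball c e.

(* [diam] and [diam_cells] are extended-real suprema, so they are the genuine
   suprema for nonempty sets; the cells of a partition are nonempty. *)
Definition diam (R : realType) (M : metricType R) (A : set M) : \bar R :=
  ereal_sup [set (mdist x y)%:E | x in A & y in A].

Definition diam_cells (R : realType) (M : metricType R)
    (F : set (set M)) : \bar R :=
  ereal_sup [set diam A | A in F].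

Definition admissible (R : realType) (M : metricType R)
    (F : nat -> set (set M)) : Prop :=
  [/\ forall j, partition (F j) id setT,
      (F 0%N #= `I_1)%card
    & forall j, (1 <= j)%N -> (F j #<= `I_(2 ^ (2 ^ j)))%card].

Definition gamma2 (R : realType) (alpha : R) (M : metricType R) : \bar R :=
  ereal_inf [set (\sum_(0 <= j <oo)
                    (2 `^ (j%:R / 2))%:E * poweR (diam_cells (F j)) alpha)%E
            | F in @admissible R M].

(* Measurability for the product of the Borel sigma-algebra of [M] with the
   sigma-algebra of [Xi]. The sigma-algebra is written out because the
   measurable structure on [g_sigma_algebraType open] needs [M] to be pointed. *)
Definition jointly_measurable (R : realType) (M : metricType R)
    (d : measure_display) (Xi : measurableType d) (G : M -> Xi -> R) : Prop :=
  forall Y : set R, measurable Y ->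
    <<s [set A `*` B | A in <<s @open M >> & B in @measurable d Xi] >>
      [set z : M * Xi | Y (G z.1 z.2)].

Definition mutually_independent (R : realType)
    (d d' : measure_display) (Omega : measurableType d) (Xi : measurableType d')
    (Pr : probability Omega R) (N : nat)
    (xi : 'I_N -> {mfun Omega >-> Xi}) : Prop :=
  forall (J : {set 'I_N}) (B : 'I_N -> set Xi),
    (forall k, measurable (B k)) ->
    (Pr (\bigcap_(k in [set` J]) (xi k @^-1` B k)) =
     \prod_(k in J) Pr (xi k @^-1` B k))%E.

Definition iid (R : realType)
    (d d' : measure_display) (Omega : measurableType d) (Xi : measurableType d')
    (Pr : probability Omega R) (P : probability Xi R) (N : nat)
    (xi : 'I_N -> {mfun Omega >-> Xi}) : Prop :=
  mutually_independent Pr xi /\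
  forall k (B : set Xi), measurable B -> distribution Pr (xi k) B = P B.

Definition empE (R : realType) (Omega Xi : Type) (N : nat)
    (xi : 'I_N -> Omega -> Xi) (w : Omega) (H : Xi -> R) : R :=
  N%:R^-1 * \sum_(k < N) H (xi k w).

Definition DeltaG (R : realType) (M : metricType R)
    (d : measure_display) (Xi : measurableType d) (P : probability Xi R)
    (Omega : Type) (N : nat) (xi : 'I_N -> Omega -> Xi)
    (G : M -> Xi -> R) (x0 : M) (w : Omega) : \bar R :=
  let D x := (fun z => G x z - G x0 z) in
  ereal_sup [set (`| (empE xi w (D x))%:E - 'E_P[D x] |)%E | x in setT].

(* The value of the completion of [Pr] at [E] is at most [p]: [E] lies in the
   completed sigma-algebra, on which the completed measure is the outer measure
   [mu_ext Pr]; for measurable [E] it is [Pr E]. The completion is needed for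
   events that are measurable only up to a null set, such as those involving an
   uncountable supremum: [Pr] has no meaning outside the measurable sets. *)
Definition completed_prob_le (R : realType) (d : measure_display)
    (Omega : measurableType d) (Pr : probability Omega R)
    (E : set Omega) (p : \bar R) : Prop :=
  completed_algebra_gen Pr E /\ (mu_ext Pr E <= p)%E.

(* Main.v *)
(** Put Z(x) = (Ê - E)(G(x, .) - G(x0, .)). The inequality
    exp(u - u^2/6) <= 1 + u + u^2/3 gives, for every square-integrable Y and
    every real l, E exp(l (Y - EY) - l^2 Y^2/6 - l^2 EY^2/3) <= 1, where Y need be
    neither bounded nor centered inside the square. Taking Y = G(x, .) - G(y, .),
    independence and Markov's inequality show that, on the event
    Ê L^2 <= 2 nu^2, the increment Z(x) - Z(y) exceeds K nu d(x, y)^alpha / sqrt N with probability at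
    most 2 exp(-3 K^2/8). A generic chaining argument concludes: the chain starts
    directly at a level n with 2^n of order 1 + t, so that t enters only through
    the first link, of length diam(M)^alpha. The constants leave some room, so an
    admissible sequence whose sum is below 9/8 gamma2 suffices. *)

Require Import Defs.
From HB Require Import structures.
From mathcomp Require Import all_boot all_order all_algebra.
From mathcomp Require Import all_classical all_reals all_analysis measurable_realfun.
From mathcomp Require Import ring lra.
Set Implicit Arguments.
Unset Strict Implicit.
Unset Printing Implicit Defensive.

Import Order.TTheory GRing.Theory Num.Theory.
Import numFieldNormedType.Exports.
Local Open Scope classical_set_scope.
Local Open Scope ring_scope.

(** * Self-normalized deviations of i.i.d. sums *)

(** The quotient [g] of the right side by the left side has derivative y^3/9 exp(y^2/6 - y), which
    has the sign of y. So [g] is smallest at 0, where it equals 1. *)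
Lemma expR_sub_sqr_le (R : realType) (x : R) :
  expR (x - x ^+ 2 / 6) <= 1 + x + x ^+ 2 / 3.
Proof.
pose g (y : R) := (1 + y + y ^+ 2 / 3) * expR (y ^+ 2 / 6 - y).
have dg (y : R) : is_derive y 1 g (y ^+ 3 / 9 * expR (y ^+ 2 / 6 - y)).
  rewrite /g.
  have H : is_derive y 1 (fun y : R => y ^+ 2 / 6 - y) (y / 3 - 1).
    apply: is_derive_eq; rewrite /GRing.scale /=.
    by field.
  have H' : is_derive y 1 (fun y : R => 1 + y + y ^+ 2 / 3) (1 + 2 / 3 * y).
    apply: is_derive_eq; rewrite /GRing.scale /=.
    by field.
  have He : is_derive y 1 (fun y : R => expR (y ^+ 2 / 6 - y))
      (expR (y ^+ 2 / 6 - y) * (y / 3 - 1)).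
    exact: (@is_derive1_comp _ expR).
  apply: is_derive_eq; rewrite /GRing.scale /=.
  by field.
have cg A : {within A, continuous g}.
  apply: continuous_subspaceT => y; apply: differentiable_continuous.
  by apply/derivable1_diffP; case: (dg y).
have g'E y : g^`()%classic y = y ^+ 3 / 9 * expR (y ^+ 2 / 6 - y).
  by rewrite derive1E; apply: derive_val.
have g1 : 1 <= g x.
  have g0 : g 0 = 1 by rewrite /g expr0n /= !mul0r !addr0 subrr expR0 mul1r.
  rewrite -g0; case: (leP 0 x) => hx.
  - apply: (@ger0_derive1_ndecry _ g 0) => //.
    move=> y; rewrite in_itv /= andbT => y0; rewrite g'E.
    by rewrite mulr_ge0 ?expR_ge0 // divr_ge0 // exprn_ge0 // ltW.
  - apply: (@ler0_derive1_nincrNy _ g 0) => //; last exact: ltW.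
    move=> y; rewrite in_itv /= => y0; rewrite g'E.
    rewrite mulr_le0_ge0 ?expR_ge0 // pmulr_lle0 ?invr_gt0 //.
    by rewrite exprS nmulr_rle0 // exprn_even_ge0.
have : 1 * expR (x - x ^+ 2 / 6) <= g x * expR (x - x ^+ 2 / 6).
  by rewrite ler_pM2r ?expR_gt0.
by rewrite mul1r /g -mulrA -expRD addrA subrK subrr expR0 mulr1.
Qed.

Section MultiplyByComposition.
Import HBSimple HBNNSimple.

(** The factorization passes from indicators to simple functions by linearity and to [f] by monotone
    convergence on both sides. In the application [h] is the product over the other coordinates and
    [c] the product of their integrals. *)
Lemma ge0_integral_mul_comp (R : realType) (d d' : measure_display)
    (Omega : measurableType d) (Xi : measurableType d')
    (mu : {measure set Omega -> \bar R}) (P : {measure set Xi -> \bar R})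
    (X : {mfun Omega >-> Xi}) (h : Omega -> R) (c : R) (f : Xi -> R) :
  measurable_fun setT h -> (forall w, 0 <= h w) -> 0 <= c ->
  (forall B, measurable B ->
    (\int[mu]_w (h w * \1_B (X w))%:E = c%:E * P B)%E) ->
  measurable_fun setT f -> (forall z, 0 <= f z) ->
  (\int[mu]_w (h w * f (X w))%:E = c%:E * \int[P]_z (f z)%:E)%E.
Proof.
move=> mh h0 c0 hB mf f0.
have mfE : measurable_fun setT (EFin \o f) by exact/measurable_EFinP.
pose g := nnsfun_approx measurableT mfE.
have cvg_g z : (EFin (g n z)) @[n --> \oo] --> (f z)%:E.
  apply: (cvg_nnsfun_approx measurableT mfE) => //.
  by move=> y _; rewrite lee_fin.
have ndg z : {homo (fun n => g n z) : n m / (n <= m)%N >-> n <= m}.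
  move=> n m nm; have := nd_nnsfun_approx measurableT mfE nm.
  by move=> /lefP/(_ z).
have step n : (\int[mu]_w (h w * g n (X w))%:E
    = c%:E * \int[P]_z (g n z)%:E)%E.
  transitivity (\int[mu]_w (\sum_(r \in range (g n))
      (r * (h w * \1_(g n @^-1` [set r]) (X w)))%:E))%E.
    apply: eq_integral => w _.
    rewrite fsumEFin // (fimfunE (g n) (X w)); congr EFin.
    rewrite mulr_fsumr; apply: eq_fsbigr => r _.
    by rewrite mulrCA.
  have mterm r : measurable_fun setT
      (fun w => (h w * \1_(g n @^-1` [set r]) (X w))).
    apply: measurable_funM => //.
    suff : measurable_fun setT ((\1_(g n @^-1` [set r]) : Xi -> R) \o X) by [].
    exact: measurableT_comp.
  rewrite ge0_integral_fsum //; last 2 first.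
    by move=> r; apply/measurable_EFinP; exact: measurable_funM.
    move=> r w _; rewrite lee_fin.
    (* Only values of [g n] are known to be nonnegative; for any other [r] the preimage is empty and
       the term is 0. *)
    have [[z _ <-]|nr] := pselect (range (g n) r).
      by rewrite !mulr_ge0.
    rewrite preimage10 ?indic0 ?mulr0 //.
  rewrite integralT_nnsfun sintegralE.
  rewrite ge0_mule_fsumr; last first.
    by move=> r; exact: nnsfun_mulemu_ge0.
  apply: eq_fsbigr => r /set_mem[z _ <-].
  rewrite (eq_integral (fun w => ((g n z)%:E *
      (h w * \1_(g n @^-1` [set g n z]) (X w))%:E)%E)); last first.
    by move=> w _; rewrite EFinM.
  rewrite ge0_integralZl //.
  - by rewrite hB // muleCA.
  - exact/measurable_EFinP.
  - by move=> w _; rewrite lee_fin mulr_ge0.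
  - by rewrite lee_fin.
have mgE : forall n, measurable_fun setT (fun z => (g n z)%:E).
  by move=> n; apply/measurable_EFinP.
have lim1 : ((\int[mu]_w (h w * g n (X w))%:E) @[n --> \oo] -->
    \int[mu]_w (h w * f (X w))%:E)%E.
  have -> : (\int[mu]_w (h w * f (X w))%:E =
      \int[mu]_w limn (fun n => (h w * g n (X w))%:E))%E.
    apply: eq_integral => w _; apply/esym/cvg_lim => //.
    under eq_fun do rewrite EFinM.
    by rewrite EFinM; apply: cvgeZl.
  apply: cvg_monotone_convergence => //.
  - move=> n; apply/measurable_EFinP; apply: measurable_funM => //.
    exact: measurableT_comp.
  - by move=> n w _; rewrite lee_fin mulr_ge0.
  - by move=> w _ n m nm; rewrite lee_fin ler_wpM2l // ndg.
have lim2 : ((\int[P]_z (g n z)%:E) @[n --> \oo] --> \int[P]_z (f z)%:E)%E.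
  have -> : (\int[P]_z (f z)%:E = \int[P]_z limn (fun n => (g n z)%:E))%E.
    by apply: eq_integral => z _; apply/esym/cvg_lim.
  apply: cvg_monotone_convergence => //.
  - by move=> n z _; rewrite lee_fin.
  - by move=> z _ n m nm; rewrite lee_fin ndg.
move: lim1; under eq_fun do rewrite step.
move=> /cvg_lim <- //; apply/cvg_lim => //.
exact: cvgeZl.
Qed.

End MultiplyByComposition.

Lemma ge0_integral_prod_iid (R : realType) (d d' : measure_display)
    (Omega : measurableType d) (Xi : measurableType d')
    (Pr : probability Omega R) (P : probability Xi R) (N : nat)
    (xi : 'I_N -> {mfun Omega >-> Xi}) (f : 'I_N -> Xi -> R) :
  iid Pr P xi ->
  (forall k, measurable_fun setT (f k)) -> (forall k z, 0 <= f k z) ->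
  (forall k, \int[P]_z (f k z)%:E < +oo)%E ->
  (\int[Pr]_w (\prod_(k < N) f k (xi k w))%:E =
   \prod_(k < N) \int[P]_z (f k z)%:E)%E.
Proof.
move=> [indep law] mf f0 foo.
have lawE k B : measurable B -> Pr (xi k @^-1` B) = P B by exact: law.
(* Replace the indicators of independence by general functions, one coordinate
   at a time. *)
suff main m : forall (g : 'I_N -> Xi -> R),
    (forall k, measurable_fun setT (g k)) -> (forall k z, 0 <= g k z) ->
    (forall k, \int[P]_z (g k z)%:E < +oo)%E ->
    (forall k : 'I_N, (m <= k)%N ->
       exists2 B, measurable B & g k = \1_B) ->
    (\int[Pr]_w (\prod_(k < N) g k (xi k w))%:E =
     \prod_(k < N) \int[P]_z (g k z)%:E)%E.
  by apply: (main N) => // k; rewrite leqNgt ltn_ord.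
elim: m => [|m IH] g mg g0 goo gind.
  (* All factors are indicators here, so the integral is the probability of an intersection and
     independence applies literally. *)
  have /choice[B hB] k : exists B, measurable B /\ g k = \1_B.
    by have [B] := gind k isT; exists B.
  transitivity (Pr (\bigcap_(k in [set` [set: 'I_N]%SET]) (xi k @^-1` B k))).
    rewrite -[X in Pr X]setIT -integral_indic //; last first.
      apply: fin_bigcap_measurable => // k _.
      by rewrite -[X in measurable X]setTI; apply: measurable_funPT => //;
        case: (hB k).
    apply: eq_integral => w _; congr EFin.
    rewrite indicE; case: (boolP (w \in _)) => [/set_mem wB|wB].
      rewrite big1 // => k _; have [_ ->] := hB k.
      by rewrite indicE mem_set //; apply: wB; rewrite /= inE.
    have [k kB] : exists k, ~ B k (xi k w).
      apply/existsNP => wall; move/negP: wB; apply.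
      by apply/mem_set => k _; apply: wall.
    rewrite (bigD1 k) //=; have [_ ->] := hB k.
    by rewrite indicE memNset // mul0r.
  rewrite indep; last by move=> k; case: (hB k).
  rewrite big_mkcond /=; apply: eq_bigr => k _; rewrite inE.
  have [mB gE] := hB k.
  by rewrite lawE // gE integral_indic // setIT.
have [mN|Nm] := ltnP m N; last first.
  by apply: IH => // k mk; have := leq_trans Nm mk; rewrite leqNgt ltn_ord.
pose km := Ordinal mN.
(* Coordinate [m] is singled out. Finiteness of the other integrals makes their product a real
   constant. *)
pose c := fine (\prod_(k < N | k != km) \int[P]_z (g k z)%:E)%E.
have int_fin k : (\int[P]_z (g k z)%:E)%E \is a fin_num.
  by rewrite ge0_fin_numE //; apply: integral_ge0 => z _; rewrite lee_fin.
have cE : (c%:E = \prod_(k < N | k != km) \int[P]_z (g k z)%:E)%E.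
  rewrite fineK //.
  by elim/big_ind: _ => // x y; exact: fin_numM.
pose h w := \prod_(k < N | k != km) g k (xi k w).
have h0 w : 0 <= h w by apply: prodr_ge0.
have mh : measurable_fun setT h.
  rewrite /h; under eq_fun do rewrite -big_filter.
  apply: measurable_prod => k _; exact: measurableT_comp.
under eq_integral => w _ do rewrite (bigD1 km) //= mulrC.
rewrite (bigD1 km) //= -cE muleC.
apply: (@ge0_integral_mul_comp _ _ _ _ _ Pr P (xi km) h c (g km)) => //.
  rewrite /c fine_ge0 //; apply: prode_ge0 => k _.
  by apply: integral_ge0 => z _; rewrite lee_fin.
move=> B mB.
(* With an indicator back in coordinate [m], the induction hypothesis applies to [g']. *)
pose g' k := if k == km then \1_B else g k.
have g'km : g' km = \1_B by rewrite /g' eqxx.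
have g'E k : k != km -> g' k = g k by rewrite /g' => /negbTE ->.
transitivity (\int[Pr]_w (\prod_(k < N) g' k (xi k w))%:E)%E.
  apply: eq_integral => w _; rewrite (bigD1 km) //= g'km mulrC.
  by congr (_ * _)%:E; apply: eq_bigr => k /g'E ->.
rewrite IH.
- rewrite (bigD1 km) //= g'km integral_indic // setIT muleC cE.
  by congr (_ * _)%E; apply: eq_bigr => k /g'E ->.
- by move=> k; rewrite /g'; case: ifP.
- by move=> k z; rewrite /g'; case: ifP.
- move=> k; rewrite /g'; case: ifP => // _.
  by rewrite integral_indic // setIT (le_lt_trans (probability_le1 P mB)) ?ltry.
- move=> k mk; have [->|kkm] := eqVneq k km; first by exists B.
  rewrite g'E //; apply: gind; rewrite ltn_neqAle mk andbT eq_sym.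
  by apply: contra kkm => /eqP km_eq; apply/eqP/val_inj.
Qed.

(** Domination by 1 + Y^2, whose constant part is integrable for a probability. *)
Lemma integrable_of_sqr (R : realType) (d : measure_display)
    (Xi : measurableType d) (P : probability Xi R) (Y : Xi -> R) :
  measurable_fun setT Y -> (\int[P]_z (Y z ^+ 2)%:E < +oo)%E ->
  P.-integrable setT (EFin \o Y).
Proof.
move=> mY Y2.
have i2 : P.-integrable setT (EFin \o (fun z => Y z ^+ 2)).
  apply/integrableP; split.
    by apply/measurable_EFinP; exact: measurable_funX.
  under eq_integral => z _ do rewrite /= ger0_norm ?sqr_ge0 //.
  exact: Y2.
have i1 : P.-integrable setT (EFin \o (fun z => 1 + Y z ^+ 2)).
  exact: (integrableD measurableT (finite_measure_integrable_cst P 1 measurableT) i2).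
apply: le_integrable i1 => //; first exact/measurable_EFinP.
move=> z _ /=; rewrite lee_fin [leRHS]ger0_norm ?addr_ge0 ?sqr_ge0 //.
rewrite -(normr_id (Y z)) -[Y z ^+ 2]real_normK ?num_real // normr_id.
by nra.
Qed.

(** Integrating [expR_sub_sqr_le] at l Y bounds E exp(l Y - l^2 Y^2/6) by 1 + l EY + l^2 EY^2/3,
    hence by exp(l EY + l^2 v/3); the remaining terms of the exponent cancel this. *)
Lemma self_normalized_mgf_le1 (R : realType) (d : measure_display)
    (Xi : measurableType d) (P : probability Xi R) (Y : Xi -> R) (v l : R) :
  measurable_fun setT Y -> (\int[P]_z (Y z ^+ 2)%:E <= v%:E)%E ->
  (\int[P]_z (expR (l * (Y z - fine (\int[P]_y (Y y)%:E))
      - l ^+ 2 * Y z ^+ 2 / 6 - l ^+ 2 * v / 3))%:E <= 1)%E.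
Proof.
move=> mY Yv.
have Y2oo : (\int[P]_z (Y z ^+ 2)%:E < +oo)%E.
  by apply: le_lt_trans Yv _; rewrite ltry.
have iY := integrable_of_sqr mY Y2oo.
set m := fine _.
have mE : (\int[P]_y (Y y)%:E = m%:E)%E.
  by rewrite fineK // integrable_fin_num.
have mY2 : measurable_fun setT (fun z => Y z ^+ 2) by exact: measurable_funX.
have i2 : P.-integrable setT (EFin \o (fun z => Y z ^+ 2)).
  apply/integrableP; split; first exact/measurable_EFinP.
  under eq_integral => z _ do rewrite /= ger0_norm ?sqr_ge0 //.
  exact: Y2oo.
have [V VE] : exists V, (\int[P]_z (Y z ^+ 2)%:E = V%:E)%E.
  by exists (fine (\int[P]_z (Y z ^+ 2)%:E)%E); rewrite fineK // integrable_fin_num.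
have Vv : V <= v by rewrite -lee_fin -VE.
pose c := expR (- (l * m + l ^+ 2 * v / 3)).
(* The quadratic majorant of the integrand; [c] collects the factors that do not depend on [z]. *)
pose r z := c + (c * l) * Y z + (c * l ^+ 2 / 3) * Y z ^+ 2.
have ir : P.-integrable setT (EFin \o r) /\
   (\int[P]_z (r z)%:E = (c + c * l * m + c * l ^+ 2 / 3 * V)%:E)%E.
  have ic : P.-integrable setT (EFin \o cst c) by exact: finite_measure_integrable_cst.
  have i1 : P.-integrable setT (fun z => (c * l)%:E * (Y z)%:E)%E.
    exact: integrableZl.
  have i3 : P.-integrable setT (fun z => (c * l ^+ 2 / 3)%:E * (Y z ^+ 2)%:E)%E.
    exact: integrableZl.
  have i12 := integrableD measurableT ic i1.
  have rE : EFin \o r = (((EFin \o cst c) \+ (fun z => (c * l)%:E * (Y z)%:E)) \+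
     (fun z => (c * l ^+ 2 / 3)%:E * (Y z ^+ 2)%:E))%E by [].
  split; first by rewrite rE; exact: integrableD.
  under eq_integral => z _ do rewrite -[(r z)%:E]/((EFin \o r) z) rE.
  rewrite integralD // integralD // !integralZl // mE VE.
  rewrite [X in (X + _ + _)%E](_ : _ = c%:E) //.
  by rewrite (integral_cst P measurableT c%:E) /= probability_setT mule1.
have [ir1 rI] := ir.
apply: (@le_trans _ _ (\int[P]_z (r z)%:E)%E).
  apply: ge0_le_integral => //.
  - apply/measurable_EFinP; apply: measurableT_comp => //.
    apply: measurable_funB => //; apply: measurable_funB.
      by apply: measurable_funM => //; apply: measurable_funB.
    by apply: measurable_funM => //; exact: measurable_funM.
  - by case/integrableP : ir1.
  - move=> z _; rewrite lee_fin /r.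
    have -> : l * (Y z - m) - l ^+ 2 * Y z ^+ 2 / 6 - l ^+ 2 * v / 3 =
      - (l * m + l ^+ 2 * v / 3) + (l * Y z - (l * Y z) ^+ 2 / 6) by field.
    rewrite expRD -/c.
    have -> : c + c * l * Y z + c * l ^+ 2 / 3 * Y z ^+ 2 =
       c * (1 + l * Y z + (l * Y z) ^+ 2 / 3) by field.
    by rewrite ler_pM2l ?expR_gt0 // expR_sub_sqr_le.
rewrite rI lee_fin.
have -> : c + c * l * m + c * l ^+ 2 / 3 * V = c * (1 + l * m + l ^+ 2 * V / 3) by field.
rewrite /c expRN ler_pdivrMl ?expR_gt0 // mulr1.
apply: le_trans (expR_ge1Dx _); rewrite -addrA lerD2l lerD2l.
rewrite ler_pM2r ?invr_gt0 // ler_wpM2l ?sqr_ge0 //.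
Qed.

Lemma measurable_lt_fun (R : realType) (d : measure_display)
    (T : measurableType d) (f g : T -> R) :
  measurable_fun setT f -> measurable_fun setT g ->
  measurable [set x | f x < g x].
Proof.
move=> mf mg; rewrite (_ : [set x | _] = ~` (setT `&` [set x | g x <= f x])).
  by apply: measurableC; exact: measurable_fun_le.
by rewrite setTI; apply/seteqP; split => x /=; rewrite ltNge => /negP.
Qed.

Lemma integral_eq0_of_sqr (R : realType) (d : measure_display)
    (Xi : measurableType d) (P : probability Xi R) (Y : Xi -> R) :
  measurable_fun setT Y -> (\int[P]_z (Y z ^+ 2)%:E <= 0)%E ->
  (\int[P]_z (Y z)%:E = 0)%E.
Proof.
move=> mY Y2le0.
have Y2 : (\int[P]_z `|(Y z ^+ 2)%:E| = 0)%E.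
  under eq_integral => z _ do rewrite /= ger0_norm ?sqr_ge0 //.
  apply/eqP; rewrite eq_le Y2le0 /=.
  by apply: integral_ge0 => z _; rewrite lee_fin sqr_ge0.
have mY2 : measurable_fun setT (EFin \o (fun z => Y z ^+ 2)).
  by apply/measurable_EFinP; exact: measurable_funX.
have /(ae_eq_integral_abs P measurableT mY2) Y20 := Y2.
rewrite (@ae_eq_integral _ _ _ P setT (cst 0%E)) // ?integral0 //.
  exact/measurable_EFinP.
apply: filterS Y20 => z /(_ I) /= [/eqP]; rewrite sqrf_eq0 => /eqP ->.
by [].
Qed.

(** On the event the sum of squares is at most 2 N v, so the two quadratic corrections together cost
    at most 2/3 l^2 N v. Markov's inequality for the product of the exponentials then gives the
    bound. *)
Lemma self_normalized_tail (R : realType) (d d' : measure_display)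
    (Omega : measurableType d) (Xi : measurableType d')
    (Pr : probability Omega R) (P : probability Xi R) (N : nat)
    (xi : 'I_N -> {mfun Omega >-> Xi}) (Y : Xi -> R) (v K : R) :
  (0 < N)%N -> iid Pr P xi -> measurable_fun setT Y -> 0 <= v ->
  (\int[P]_z (Y z ^+ 2)%:E <= v%:E)%E -> 0 <= K ->
  (Pr [set w | (\sum_(k < N) Y (xi k w) ^+ 2 <= 2 * (N%:R * v) /\
        K * Num.sqrt (N%:R * v) <
        \sum_(k < N) (Y (xi k w) - fine (\int[P]_y (Y y)%:E)))%R]
    <= (expR (- (3 / 8 * K ^+ 2)))%:E)%E.
Proof.
move=> N0 hxi mY v0 Yv K0.
set m := fine _.
set E := [set w | _].
have mYxi k : measurable_fun setT (fun w => Y (xi k w)) by exact: measurableT_comp.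
have mE : measurable E.
  rewrite (_ : E = [set w | \sum_(k < N) Y (xi k w) ^+ 2 <= 2 * (N%:R * v)] `&`
    [set w | K * Num.sqrt (N%:R * v) < \sum_(k < N) (Y (xi k w) - m)]) //.
  apply: measurableI.
  - rewrite -[X in measurable X]setTI; apply: measurable_fun_le => //.
    by apply: measurable_sum => k; exact: measurable_funX.
  - apply: measurable_lt_fun => //.
    by apply: measurable_sum => k; exact: measurable_funB.
(* The choice of [l] below divides by sqrt(N v). If v = 0, the event forces every Y(xi_k) to vanish,
   the mean vanishes too, and the strict inequality fails. *)
have [v_eq0|v_neq0] := eqVneq v 0.
  have m0 : m = 0.
    by rewrite /m integral_eq0_of_sqr // -[leRHS]/(0%:E) -v_eq0.
  rewrite (_ : E = set0) ?measure0 ?lee_fin ?expR_ge0 //.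
  rewrite -subset0 => w [].
  rewrite v_eq0 mulr0 sqrtr0 !mulr0 m0 => Y2 /=.
  have Y0 k : Y (xi k w) = 0.
    apply/eqP; rewrite -sqrf_eq0 eq_le sqr_ge0 andbT.
    apply: le_trans Y2; rewrite (bigD1 k) //= lerDl.
    by apply: sumr_ge0 => *; exact: sqr_ge0.
  by rewrite big1 ?ltxx // => k _; rewrite Y0 subr0.
have Nv0 : 0 < N%:R * v by rewrite mulr_gt0 ?ltr0n // lt_neqAle eq_sym v_neq0.
set q := Num.sqrt (N%:R * v).
have q0 : 0 < q by rewrite sqrtr_gt0.
have q2 : N%:R * v = q ^+ 2 by rewrite sqr_sqrtr // ltW.
(* [l] maximizes [l K q - 2/3 l^2 q^2], whose maximum is [3/8 K^2]. *)
pose l := 3 * K / (4 * q).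
pose f z := expR (l * (Y z - m) - l ^+ 2 * Y z ^+ 2 / 6 - l ^+ 2 * v / 3).
have mf : measurable_fun setT f.
  apply: measurableT_comp => //; apply: measurable_funB => //.
  apply: measurable_funB; first by apply: measurable_funM => //; exact: measurable_funB.
  by apply: measurable_funM => //; apply: measurable_funM => //; exact: measurable_funX.
have f0 z : 0 <= f z by exact: expR_ge0.
have f1 : (\int[P]_z (f z)%:E <= 1)%E by exact: self_normalized_mgf_le1.
have foo : (\int[P]_z (f z)%:E < +oo)%E by apply: le_lt_trans f1 _; rewrite ltry.
rewrite -[E]setIT -integral_indic //.
set c := expR (- _).
have mprod : measurable_fun setT (fun w => \prod_(k < N) f (xi k w)).
  by apply: measurable_prod => k _; exact: measurableT_comp.
have p0 w : 0 <= \prod_(k < N) f (xi k w) by exact: prodr_ge0.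
(* Markov's inequality in integral form: the indicator of [E] is at most [c] times the product. *)
apply: (@le_trans _ _ (\int[Pr]_w (c%:E * (\prod_(k < N) f (xi k w))%:E))%E).
  apply: ge0_le_integral => //.
  - exact/measurable_EFinP.
  - apply/measurable_EFinP; exact: measurable_funM.
  move=> w _; rewrite -EFinM lee_fin indicE.
  case: (boolP (w \in E)) => [/set_mem[Y2 Ys]|_]; last first.
    by rewrite mulr_ge0 ?expR_ge0.
  rewrite /f -expR_sum /c -expRD -[leLHS]expR0 ler_expR -/q in Ys *.
  set S := \sum_(i < N) (Y (xi i w) - m) in Ys *.
  set T := \sum_(i < N) Y (xi i w) ^+ 2 in Y2 *.
  rewrite [X in _ + X](_ : _ = l * S - l ^+ 2 * T / 6 - l ^+ 2 * (N%:R * v) / 3); last first.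
    rewrite 2!sumrB sumr_const card_ord -[_ *+ N]mulr_natl; congr (_ - _ - _).
    - by rewrite mulr_sumr.
    - by rewrite mulr_sumr mulr_suml.
    - by field.
  rewrite q2 in Y2 *.
  have l0 : 0 <= l by rewrite divr_ge0 // ?mulr_ge0 // ltW.
  have lS : l * (K * q) <= l * S by rewrite ler_wpM2l // ltW.
  have lT : l ^+ 2 * T <= l ^+ 2 * (2 * q ^+ 2) by rewrite ler_wpM2l ?sqr_ge0.
  have lKq : l * (K * q) = 3 / 4 * K ^+ 2 by rewrite /l; field; rewrite gt_eqF.
  have lq : l ^+ 2 * q ^+ 2 = 9 / 16 * K ^+ 2 by rewrite /l; field; rewrite gt_eqF.
  move: lS lT; rewrite lKq mulrCA lq => lS lT.
  set A := l * S in lS *; set B := l ^+ 2 * T in lT *.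
  by lra.
rewrite ge0_integralZl_EFin ?expR_ge0 //; last 2 first.
- by move=> w _; rewrite lee_fin.
- exact/measurable_EFinP.
rewrite -[leRHS]mule1 lee_pmul2l ?lte_fin ?expR_gt0 //.
rewrite (ge0_integral_prod_iid hxi (f := fun=> f)) //.
have If0 : (0 <= \int[P]_z (f z)%:E)%E by apply: integral_ge0 => z _; rewrite lee_fin.
elim: (index_enum _) => [|k s IHs]; first by rewrite big_nil lexx.
rewrite big_cons -[leRHS]mule1; apply: lee_pmul => //.
exact: prode_ge0.
Qed.

(** The one-sided bound is applied to Y and to -Y. Measurability is kept in the conclusion so that
    [Pr] of this event can later be read as its outer measure. *)
Lemma self_normalized_tail2 (R : realType) (d d' : measure_display)
    (Omega : measurableType d) (Xi : measurableType d')
    (Pr : probability Omega R) (P : probability Xi R) (N : nat)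
    (xi : 'I_N -> {mfun Omega >-> Xi}) (Y : Xi -> R) (v K : R) :
  (0 < N)%N -> iid Pr P xi -> measurable_fun setT Y -> 0 <= v ->
  (\int[P]_z (Y z ^+ 2)%:E <= v%:E)%E -> 0 <= K ->
  measurable [set w | \sum_(k < N) Y (xi k w) ^+ 2 <= 2 * (N%:R * v) /\
        K * Num.sqrt (N%:R * v) <
        `|\sum_(k < N) (Y (xi k w) - fine (\int[P]_y (Y y)%:E))|] /\
  (Pr [set w | (\sum_(k < N) Y (xi k w) ^+ 2 <= 2 * (N%:R * v) /\
        K * Num.sqrt (N%:R * v) <
        `|\sum_(k < N) (Y (xi k w) - fine (\int[P]_y (Y y)%:E))|)%R]
    <= (2 * expR (- (3 / 8 * K ^+ 2)))%:E)%E.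
Proof.
move=> N0 hxi mY v0 Yv K0.
pose E (Z : Xi -> R) := [set w | \sum_(k < N) Z (xi k w) ^+ 2 <= 2 * (N%:R * v) /\
  K * Num.sqrt (N%:R * v) < \sum_(k < N) (Z (xi k w) - fine (\int[P]_y (Z y)%:E))].
have mE Z : measurable_fun setT Z -> measurable (E Z).
  move=> mZ; have mZxi k : measurable_fun setT (fun w => Z (xi k w)).
    exact: measurableT_comp.
  apply: measurableI.
  - rewrite -[X in measurable X]setTI; apply: measurable_fun_le => //.
    by apply: measurable_sum => k; exact: measurable_funX.
  - apply: measurable_lt_fun => //.
    by apply: measurable_sum => k; exact: measurable_funB.
have mNY : measurable_fun setT (fun z => - Y z) by exact: measurableT_comp.
have NYv : (\int[P]_z ((- Y z) ^+ 2)%:E <= v%:E)%E.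
  by under eq_integral => z _ do rewrite sqrrN.
rewrite (_ : [set w | _] = E Y `|` E (fun z => - Y z)); last first.
  have mN : fine (\int[P]_y (- Y y)%:E)%E = - fine (\int[P]_y (Y y)%:E)%E.
    under eq_integral do rewrite EFinN.
    rewrite integralN ?fineN //; apply: integrable_add_def => //.
    by apply: integrable_of_sqr => //; apply: le_lt_trans Yv _; rewrite ltry.
  have SN w : \sum_(k < N) (- Y (xi k w) - fine (\int[P]_y (- Y y)%:E)) =
      - \sum_(k < N) (Y (xi k w) - fine (\int[P]_y (Y y)%:E)).
    by rewrite mN -sumrN; apply: eq_bigr => k _; rewrite opprB opprK addrC.
  have QN w : \sum_(k < N) (- Y (xi k w)) ^+ 2 = \sum_(k < N) Y (xi k w) ^+ 2.
    by apply: eq_bigr => k _; rewrite sqrrN.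
  apply/seteqP; split => w; rewrite /E /= SN QN.
  - by case=> ->; rewrite ltr_normr => /orP[]; [left|right].
  - by case=> -[-> H]; split => //; rewrite ltr_normr H ?orbT.
split; first by apply: measurableU; exact: mE.
apply: le_trans (measureU2 _ _ _) _; [exact: mE | exact: mE |].
by rewrite mulr_natl mulr2n EFinD leeD // self_normalized_tail.
Qed.

(** * Generic chaining *)

(** For s = x + y > 0 and u in [0, s], the ratio u/s is at most (u/s)^a because a <= 1; summing over
    u = x and u = y gives the claim. *)
Lemma powR_subadditive (R : realType) (a x y : R) :
  0 < a -> a <= 1 -> 0 <= x -> 0 <= y -> (x + y) `^ a <= x `^ a + y `^ a.
Proof.
move=> a0 a1 x0 y0.
have [->|xy0] := eqVneq (x + y) 0.
  by rewrite powR0 ?gt_eqF // addr_ge0 ?powR_ge0.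
have s0 : 0 < x + y by rewrite lt_neqAle eq_sym xy0 addr_ge0.
have H u : 0 <= u -> u <= x + y -> u / (x + y) * (x + y) `^ a <= u `^ a.
  move=> u0 us.
  have -> : u `^ a = (u / (x + y)) `^ a * (x + y) `^ a.
    by rewrite -powRM ?divr_ge0 ?(ltW s0) // divfK.
  rewrite ler_wpM2r ?powR_ge0 //.
  have [->|u_neq0] := eqVneq u 0; first by rewrite mul0r powR_ge0.
  have u1 : 0 < u / (x + y) <= 1.
    apply/andP; split; last by rewrite ler_pdivrMr // mul1r.
    by rewrite divr_gt0 // lt_neqAle eq_sym u_neq0.
  rewrite -[leLHS](powRr1 (ltW (proj1 (andP u1)))).
  exact: ger_powR.
apply: le_trans (lerD (H x x0 _) (H y y0 _)); rewrite ?lerDl ?lerDr //.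
by rewrite -mulrDl -mulrDl divff // mul1r.
Qed.

Lemma outer_measure_finite_union_le (R : realType) (T : Type)
    (mu : {outer_measure set T -> \bar R}) (F : nat -> set T) (n : nat) (c : R) :
  (forall k, (k < n)%N -> mu (F k) <= c%:E)%E ->
  (mu (\bigcup_(k in `I_n) F k) <= (n%:R * c)%:E)%E.
Proof.
move=> Fc; rewrite bigcup_mkord.
apply: le_trans (outer_measure_subadditive mu F n) _.
apply: (@le_trans _ _ (\sum_(i < n) c%:E)%E); first by apply: lee_sum => i _; exact: Fc.
by rewrite sumEFin sumr_const card_ord mulr_natl.
Qed.

Lemma exp2n_le_expR (R : realType) (n : nat) : ((2 ^ n)%N%:R : R) <= expR n%:R.
Proof.
rewrite natrX -[n%:R]mulr1 expRM_natl.
by rewrite lerXn2r ?nnegrE ?expR_ge0 //; exact: expR_ge1Dx.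
Qed.

(** Arithmetic of the union bound: 2^a links, each failing with probability at most 2 exp(-x), fit
    into the share exp(-t)/2^b. Every factor 2 is replaced by e, whence the summand 1. *)
Lemma exp2n_mul_expRN_le (R : realType) (a b : nat) (x t : R) :
  a%:R + 1 + b%:R + t <= x ->
  (2 ^ a)%N%:R * (2 * expR (- x)) <= expR (- t) / (2 ^ b)%N%:R.
Proof.
move=> abx.
have e2 : 2 <= expR 1 :> R by have := expR_ge1Dx (1 : R).
apply: (@le_trans _ _ (expR a%:R * (expR 1 * expR (- x)))).
  apply: ler_pM; rewrite ?mulr_ge0 ?expR_ge0 ?exp2n_le_expR //.
  by rewrite ler_wpM2r ?expR_ge0.
apply: (@le_trans _ _ (expR (- t) / expR b%:R)).
  by rewrite -expRN -!expRD ler_expR; lra.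
by rewrite ler_wpM2l ?expR_ge0 // lef_pV2 ?posrE ?expR_gt0 ?exp2n_le_expR.
Qed.

(** An outer measure is used because the event quantifies over all x in [M] and need not be
    measurable. The constant C of the Hölder hypothesis may depend on w and is absent from the
    bound: it only makes the remainder of the chain tend to 0. *)
Lemma generic_chaining (R : realType) (M : metricType R) (Omega : Type)
    (mu : {outer_measure set Omega -> \bar R}) (S : M -> Omega -> R)
    (good : set Omega) (alpha sigma t D s : R) (x0 : M)
    (p : nat -> nat -> M) (e : nat -> R) :
  0 < alpha -> alpha <= 1 -> 0 <= sigma -> 0 <= t ->
  (forall x y delta K, 0 <= K -> mdist x y `^ alpha <= delta ->
    (mu (good `&` [set w | (K * sigma * delta < `|S x w - S y w|)%R])
      <= (2 * expR (- (3 / 8 * K ^+ 2)))%:E)%E) ->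
  (forall w, good w -> exists C, forall x y,
    `|S x w - S y w| <= C * mdist x y `^ alpha) ->
  (forall x, mdist x x0 `^ alpha <= D) ->
  (forall j, 0 <= e j) ->
  (forall j x, (0 < j)%N ->
    exists2 k, (k < 2 ^ 2 ^ j)%N & mdist x (p j k) `^ alpha <= e j) ->
  (forall m, \sum_(0 <= j < m) Num.sqrt 2 ^+ j * e j <= s) ->
  (mu (good `&` [set w | exists x, sigma * (Num.sqrt 6 * (1 + Num.sqrt 2) * s
      + 6 * Num.sqrt 3 * D * Num.sqrt (1 + t)) < `|S x w - S x0 w|]%R)
    <= (expR (- t))%:E)%E.
Proof.
move=> a0 a1 sigma0 t0 tail lip diamD e0 net sum_le.
set r : R := Num.sqrt 2.
have r2 : r ^+ 2 = 2 by rewrite sqr_sqrtr.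
have r1 : 1 < r by rewrite -sqrtr1 ltr_sqrt // ltr1n.
have r0 : 0 < r by apply: lt_trans r1.
(* The level at which the chain leaves [x0]. *)
have [n [n0 nl nu]] : exists n, [/\ (0 < n)%N, 2 * (1 + t) <= (2 ^ n)%N%:R
    & (2 ^ n)%N%:R <= 4 * (1 + t) :> R].
  have ex : exists n, 2 * (1 + t) <= (2 ^ n)%N%:R.
    exists (Num.trunc (2 * (1 + t))).+1.
    apply: le_trans (ltW (truncnS_gt _)) _.
    by rewrite ler_nat ltnW // ltn_expl.
  (* The least such n is positive since 2^0 < 2 (1 + t), and minimality at n - 1 yields the upper
     bound. *)
  case: (ex_minnP ex) => n nl nmin; exists n.
  have n0 : (0 < n)%N.
    by rewrite lt0n; apply/eqP => n_eq0; move: nl; rewrite n_eq0 expn0; lra.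
  split => //; rewrite -(prednK n0) expnS natrM.
  have : (2 ^ n.-1)%N%:R < 2 * (1 + t).
    rewrite ltNge; apply/negP => /nmin.
    by rewrite -ltnS prednK // ltnn.
  by lra.
pose bad x y delta K :=
  good `&` [set w | K * sigma * delta < `|S x w - S y w|].
(* The exponent 3/8 K0^2 = 81/2 (1 + t) amply beats the at most 2^(4 (1 + t)) endpoints of the first
   link. *)
pose K0 := 6 * Num.sqrt 3 * Num.sqrt (1 + t).
(* Here 3/8 (Kj j)^2 = 9/4 2^j, while level j has 2^(3/2 2^j) pairs. The surplus 3/4 2^j pays for t
   and for the geometric share of the level. *)
pose Kj j := Num.sqrt 6 * r ^+ j.
(* Pairs that are too far apart contribute the empty set, so the tail bound covers every pair that
   counts. *)
pose step j := \bigcup_(k in `I_(2 ^ 2 ^ j)) \bigcup_(l in `I_(2 ^ 2 ^ j.-1))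
  [set w | mdist (p j k) (p j.-1 l) `^ alpha <= e j + e j.-1 /\
     bad (p j k) (p j.-1 l) (e j + e j.-1) (Kj j) w].
pose start := \bigcup_(k in `I_(2 ^ 2 ^ n)) bad (p n k) x0 D K0.
(* Index [i] stands for level n + i and receives the share exp(-t)/2^(i+1); the shares add up to
   exp(-t). *)
pose E i := if i is i'.+1 then step (n + i)%N else start.
have mu_start : (mu start <= (expR (- t) / (2 ^ 1)%N%:R)%:E)%E.
  apply: le_trans (outer_measure_finite_union_le _) _ => [k _|].
    by apply: tail (diamD _); rewrite !mulr_ge0 ?sqrtr_ge0.
  rewrite lee_fin; apply: exp2n_mul_expRN_le.
  rewrite /K0 !exprMn !sqr_sqrtr ?addr_ge0 //.
  by lra.
have mu_step i : (0 < i)%N -> (mu (step (n + i)%N) <= (expR (- t) / (2 ^ i.+1)%N%:R)%:E)%E.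
  move=> i0.
  apply: le_trans (outer_measure_finite_union_le _) _ => [k _|].
    apply: outer_measure_finite_union_le => l _.
    have [close|nclose] := leP (mdist (p (n + i)%N k) (p (n + i).-1 l) `^ alpha)
      (e (n + i)%N + e (n + i).-1).
      apply: le_trans (le_outer_measure _ _ _ _) (tail _ _ _ (Kj (n + i)%N) _ close).
      - by move=> w [].
      - by rewrite mulr_ge0 ?sqrtr_ge0 // exprn_ge0 // ltW.
    rewrite (_ : [set w | _] = set0) ?outer_measure0.
      by rewrite lee_fin mulr_ge0 // expR_ge0.
    by rewrite -subset0 => w [].
  rewrite lee_fin mulrA -natrM -expnD; apply: exp2n_mul_expRN_le.
  rewrite /Kj exprMn sqr_sqrtr // -exprM mulnC exprM r2.
  case: i i0 => // i _.
  rewrite addnS /= natrD expnS natrM -natrX.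
  rewrite expnS natrM expnD natrM.
  set X : R := (2 ^ n)%N%:R in nl nu *; set Y : R := (2 ^ i)%N%:R.
  have Yi : i.+1%:R <= Y by rewrite ler_nat ltn_expl.
  have : 2 * (1 + t) * i.+1%:R <= X * Y by rewrite ler_pM // mulr_ge0 // addr_ge0.
  have : 0 <= t * i%:R by rewrite mulr_ge0.
  rewrite -![i.+2]addn1 -![i.+1]addn1 !natrD.
  have : 0 <= i%:R :> R by [].
  set u : R := i%:R; set Z := X * Y; lra.
apply: (@le_trans _ _ (mu (\bigcup_i E i))); last first.
  apply: le_trans (outer_measure_sigma_subadditive mu E) _.
  apply: le_trans (epsilon_trick0 _ (expR_ge0 _)).
  apply: lee_nneseries => [i _ _|i _]; first exact: outer_measure_ge0.
  by case: i => [|i] //; exact: mu_step.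
(* From here on the argument is deterministic: outside all [E i], every link of every chain obeys
   its bound. *)
apply: le_outer_measure => w [gw [x]]; apply: contraPP => nE.
apply/negP; rewrite -leNgt.
have startP k : (k < 2 ^ 2 ^ n)%N -> `|S (p n k) w - S x0 w| <= K0 * sigma * D.
  move=> kn; rewrite leNgt; apply/negP => lt; apply: nE.
  by exists 0%N => //; exists k.
have stepP j k l : (n < j)%N -> (k < 2 ^ 2 ^ j)%N -> (l < 2 ^ 2 ^ j.-1)%N ->
    mdist (p j k) (p j.-1 l) `^ alpha <= e j + e j.-1 ->
    `|S (p j k) w - S (p j.-1 l) w| <= Kj j * sigma * (e j + e j.-1).
  move=> nj kj lj close; rewrite leNgt; apply/negP => lt; apply: nE.
  exists (j - n)%N => //; rewrite /E.
  have -> : (j - n = (j - n.+1).+1)%N by rewrite subnS prednK // subn_gt0.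
  have -> : (n + (j - n.+1).+1 = j)%N by rewrite addnS -addSn subnKC.
  by exists k => //; exists l.
(* [q j] is the index of a net point close to x. Level 0 gets a dummy value, which the chain never
   meets because n > 0. *)
have [q qP] : exists q : nat -> nat, forall j, (0 < j)%N ->
    (q j < 2 ^ 2 ^ j)%N /\ mdist x (p j (q j)) `^ alpha <= e j.
  have /choice[q qP] j : exists k, (0 < j)%N ->
      (k < 2 ^ 2 ^ j)%N /\ mdist x (p j k) `^ alpha <= e j.
    case: j => [|j]; first by exists 0%N.
    by have [k] := net j.+1 x isT; exists k.
  by exists q.
pose z j := S (p j (q j)) w.
pose W m := \sum_(0 <= j < m) r ^+ j * e j.
have WS m : W m.+1 = W m + r ^+ m * e m by rewrite /W big_nat_recr.
(* The link to level j + 1 costs sqrt 6 sigma (r^(j+1) e_(j+1) + r r^j e_j): one new term of each of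
   two copies of the sum, the second multiplied by r. This is the origin of the factor 1 + sqrt
   2. *)
have zle m : `|z (n + m)%N - S x0 w| <= K0 * sigma * D +
    Num.sqrt 6 * sigma * (W (n + m).+1 + r * W (n + m)%N).
  elim: m => [|m IHm].
    rewrite addn0; apply: le_trans (startP _ (proj1 (qP _ n0))) _.
    rewrite lerDl !mulr_ge0 ?sqrtr_ge0 // addr_ge0 ?mulr_ge0 ?(ltW r0) //;
    by apply: sumr_ge0 => j _; rewrite mulr_ge0 // exprn_ge0 // ltW.
  rewrite addnS; set j := (n + m)%N in IHm *.
  have j0 : (0 < j)%N by rewrite addn_gt0 n0.
  have nj : (n < j.+1)%N by rewrite ltnS leq_addr.
  have close : mdist (p j.+1 (q j.+1)) (p j (q j)) `^ alpha <= e j.+1 + e j.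
    apply: (@le_trans _ _ ((mdist x (p j.+1 (q j.+1)) + mdist x (p j (q j))) `^ alpha)).
      apply: ge0_ler_powR; rewrite ?nnegrE ?addr_ge0 ?mdist_ge0 ?(ltW a0) //.
      by rewrite [mdist x (p j.+1 _)]metric_sym; exact: metric_triangle.
    apply: le_trans (powR_subadditive _ _ _ _) _; rewrite ?mdist_ge0 //.
    by apply: lerD; [exact: (proj2 (qP j.+1 isT)) | exact: (proj2 (qP j j0))].
  have := stepP j.+1 (q j.+1) (q j) nj (proj1 (qP j.+1 isT)) (proj1 (qP _ j0)) close.
  rewrite -/(z j.+1) -/(z j) /= => zstep.
  rewrite -(subrKA (z j)).
  apply: le_trans (ler_normD _ _) _.
  apply: le_trans (lerD zstep IHm) _.
  rewrite !WS.
  by rewrite le_eqVlt; apply/orP; left; apply/eqP; rewrite /Kj exprS; ring.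
have [C CP] := lip w gw.
set B := sigma * _.
(* Each term is bounded by the sum, so e_j <= s r^(-j), and the last link, from level j to x,
   vanishes as j grows. *)
have sum_term j : r ^+ j * e j <= s.
  apply: le_trans (sum_le j.+1); rewrite big_nat_recr //= lerDr.
  by apply: sumr_ge0 => i _; rewrite mulr_ge0 // exprn_ge0 // ltW.
have main j : (n <= j)%N -> `|S x w - S x0 w| <= B + `|C| * s * r^-1 ^+ j.
  move=> nj; have j0 : (0 < j)%N by apply: leq_trans nj.
  rewrite -(subrKA (z j)); apply: le_trans (ler_normD _ _) _.
  rewrite addrC; apply: lerD.
    have := zle (j - n)%N; rewrite subnKC // => /le_trans; apply.
    have Wj : W j.+1 + r * W j <= s + r * s.
      by apply: lerD; [exact: sum_le | rewrite ler_pM2l //; exact: sum_le].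
    have : Num.sqrt 6 * sigma * (W j.+1 + r * W j) <= Num.sqrt 6 * sigma * (s + r * s).
      by rewrite ler_wpM2l // mulr_ge0 ?sqrtr_ge0.
    move=> /(lerD (lexx (K0 * sigma * D))) /le_trans; apply.
    by rewrite le_eqVlt; apply/orP; left; apply/eqP; rewrite /B /K0 /r; ring.
  apply: le_trans (CP _ _) _.
  apply: (@le_trans _ _ (`|C| * e j)).
    apply: le_trans (ler_wpM2r (powR_ge0 _ _) (ler_norm C)) _.
    by rewrite ler_wpM2l //; exact: (proj2 (qP j j0)).
  rewrite -mulrA ler_wpM2l // exprVn ler_pdivlMr ?exprn_gt0 //.
  by rewrite mulrC.
have lim0 : B + `|C| * s * r^-1 ^+ j @[j --> \oo] --> B + `|C| * s * 0.
  apply: cvgD; first exact: cvg_cst.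
  apply: cvgMr; apply: cvg_expr.
  by rewrite normfV gtr0_norm // invf_lt1.
rewrite mulr0 addr0 in lim0.
apply: (ler_cvg_to (cvg_cst _) lim0).
by near=> j; apply: main; near: j; exact: nbhs_infty_ge.
Unshelve. all: by end_near.
Qed.

(** * Nets and dense sequences *)

Lemma diam_cells_ge0 (R : realType) (M : metricType R) (F : set (set M)) (x0 : M) :
  partition F id setT -> (0 <= diam_cells F)%E.
Proof.
move=> [cov _ _]; have [A FA Ax0] : cover F id x0 by rewrite cov.
apply: (@le_trans _ _ (diam A)); last by apply: ereal_sup_ubound; exists A.
by apply: ereal_sup_ubound; exists x0 => //; exists x0 => //; rewrite mdistxx.
Qed.

Lemma diam_ge0 (R : realType) (M : metricType R) (x0 : M) : (0 <= diam [set: M])%E.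
Proof. by apply: ereal_sup_ubound; exists x0 => //; exists x0 => //; rewrite mdistxx. Qed.

(** One point is chosen in each cell, the cells being enumerated by a surjection from [I_m]. An
    index whose set is empty falls back on [x0]. *)
Lemma partition_net (R : realType) (M : metricType R) (F : set (set M))
    (m : nat) (alpha : R) (x0 : M) :
  0 <= alpha -> partition F id setT -> (F #<= `I_m)%card ->
  exists p : nat -> M, forall x, exists2 k, (k < m)%N &
    ((mdist x (p k) `^ alpha)%:E <= poweR (diam_cells F) alpha)%E.
Proof.
move=> a0 partF /pcard_surjP[g gsurj].
have [cov _ _] := partF.
exists (fun k => xget x0 (g k)) => x.
have [A FA Ax] : cover F id x by rewrite cov.
have [k km gk] := gsurj A FA.
exists k => //.
have Ap : A (xget x0 (g k)) by rewrite gk; exact: (xgetPex x0 (ex_intro _ x Ax)).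
have le1 : ((mdist x (xget x0 (g k)))%:E <= diam_cells F)%E.
  apply: (@le_trans _ _ (diam A)); last by apply: ereal_sup_ubound; exists A.
  by apply: ereal_sup_ubound; exists x => //; exists (xget x0 (g k)).
rewrite -poweR_EFin; apply: gt0_ler_poweR => //.
- by rewrite in_itv /= lee_fin mdist_ge0 leey.
- by rewrite in_itv /= leey (diam_cells_ge0 x0 partF).
Qed.

(** The term j = 0 of any admissible sum has weight 1, and its only cell is the whole space. Thus a
    finite [gamma2] bounds the diameter, and a zero one makes it vanish. *)
Lemma diam_le_gamma2 (R : realType) (M : metricType R) (alpha : R) (x0 : M) :
  0 <= alpha -> (poweR (diam [set: M]) alpha <= gamma2 alpha M)%E.
Proof.
move=> a0; apply: le_ereal_inf_tmp => _ [F [partF F0 Fj] <-].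
have t0 j : (0 <= (2 `^ (j%:R / 2))%:E * poweR (diam_cells (F j)) alpha)%E.
  by apply: mule_ge0; rewrite ?lee_fin ?powR_ge0 ?poweR_ge0.
apply: le_trans (nneseries_lim_ge 1 _) => [|j _ _]; last exact: t0.
rewrite big_nat1 mul0r powRr0 mul1e.
apply: gt0_ler_poweR => //.
- by rewrite in_itv /= leey diam_ge0.
- by rewrite in_itv /= leey (diam_cells_ge0 x0 (partF 0%N)).
have /pcard_surjP[g gsurj] : (F 0%N #<= `I_1)%card by move: F0; rewrite card_eq_le => /andP[].
have F0E A : F 0%N A -> A = g 0%N.
  by move=> /gsurj[k]; rewrite /= ltnS leqn0 => /eqP -> <-.
have [cov _ _] := partF 0%N.
apply: ereal_sup_ubound; exists (g 0%N).
  have [A FA Ax0] : cover (F 0%N) id x0 by rewrite cov.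
  by rewrite -(F0E _ FA).
congr diam; apply/seteqP; split => // x _.
have [A FA Ax] : cover (F 0%N) id x by rewrite cov.
by rewrite -(F0E _ FA).
Qed.

(** The union of finite 1/(k+1)-nets is countable. The sequence inverts an injection of it into the
    naturals, with value [x0] at numbers that are not attained. *)
Lemma totally_bounded_dense_seq (R : realType) (M : metricType R) (x0 : M) :
  totally_bounded_space M ->
  exists q : nat -> M, forall x e, 0 < e -> exists n, mdist x (q n) < e.
Proof.
move=> tb.
have /choice[C CP] k : exists C : set M, finite_set C /\
    setT = \bigcup_(c in C) ball c (k.+1%:R^-1 : R).
  by have [|C ? ?] := tb (k.+1%:R^-1); [rewrite invr_gt0 | exists C].
pose Q := \bigcup_k C k.
have cQ : countable Q.
  by apply: bigcup_countable => // k _; apply: finite_set_countable; case: (CP k).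
have /pcard_injP[f finj] := cQ.
exists (fun n => xget x0 [set x | Q x /\ f x = n]) => x e e0.
have [k ke] : exists k, k.+1%:R^-1 < e.
  exists (Num.trunc e^-1).
  by rewrite invf_plt ?posrE // truncnS_gt.
have [_ CE] := CP k.
have [c Cc xc] : (\bigcup_(c in C k) ball c (k.+1%:R^-1 : R)) x by rewrite -CE.
have Qc : Q c by exists k.
exists (f c).
have -> : xget x0 [set x | Q x /\ f x = f c] = c.
  have [Qg fg] := xgetPex x0 (ex_intro (fun y => Q y /\ f y = f c) c (conj Qc erefl)).
  by apply: finj => //; rewrite inE.
rewrite metric_sym; apply: lt_trans ke.
by move: xc; rewrite ballEmdist.
Qed.

(** * The centered empirical process *)

(** The sets whose section at [x] is measurable form a sigma-algebra that contains the
    rectangles. *)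
Lemma jointly_measurable_section (R : realType) (M : metricType R)
    (d : measure_display) (Xi : measurableType d) (G : M -> Xi -> R) (x : M) :
  jointly_measurable G -> measurable_fun setT (G x).
Proof.
move=> mG _ Y mY; rewrite setTI.
pose sec (A : set (M * Xi)) := [set z | A (x, z)].
have : <<s [set A `*` B | A in <<s @open M >> & B in @measurable d Xi] >>
    `<=` [set A | measurable (sec A)].
  apply: smallest_sub; last first.
    move=> _ [A mA [B mB <-]] /=.
    have [Ax|nAx] := pselect (A x).
      by rewrite (_ : sec _ = B) //; apply/seteqP; split => z /= // [].
    by rewrite (_ : sec _ = set0) //; apply/seteqP; split => z /= // [].
  split => /=.
  - by rewrite (_ : sec set0 = set0).
  - move=> A mA; rewrite (_ : sec _ = ~` sec A) ?setTD; first exact: measurableC.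
    by apply/seteqP; split => z //= [].
  - move=> F mF; rewrite (_ : sec _ = \bigcup_k sec (F k)) //.
    exact: bigcupT_measurable.
by move=> /(_ _ (mG Y mY)).
Qed.

Lemma integral_sqr_ae_le (R : realType) (d : measure_display)
   (Xi : measurableType d) (P : probability Xi R) (Y Z : Xi -> R) :
  measurable_fun setT Y -> measurable_fun setT Z ->
  {ae P, forall z, `|Y z| <= Z z} ->
  (\int[P]_z (Y z ^+ 2)%:E <= \int[P]_z (Z z ^+ 2)%:E)%E.
Proof.
move=> mY mZ YZ.
apply: ae_ge0_le_integral => //.
- by move=> z _; rewrite lee_fin sqr_ge0.
- by apply/measurable_EFinP; exact: measurable_funX.
- by move=> z _; rewrite lee_fin sqr_ge0.
- by apply/measurable_EFinP; exact: measurable_funX.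
apply: filterS YZ => z YZ _; rewrite lee_fin -[Y z ^+ 2]real_normK ?num_real //.
by rewrite lerXn2r ?nnegrE // (le_trans _ YZ).
Qed.

Lemma ae_distribution (R : realType) (d d' : measure_display)
    (Omega : measurableType d) (Xi : measurableType d')
    (Pr : probability Omega R) (P : probability Xi R)
    (X : {mfun Omega >-> Xi}) (Q : set Xi) :
  (forall B, measurable B -> distribution Pr X B = P B) ->
  {ae P, forall z, Q z} -> {ae Pr, forall w, Q (X w)}.
Proof.
move=> law [A [mA PA QA]].
exists (X @^-1` A); split.
- by rewrite -[X in measurable X]setTI; exact: measurable_funPT.
- by have := law A mA; rewrite PA.
- by move=> w nQ; exact: QA.
Qed.

Lemma measurable_lt_EFin (R : realType) (d : measure_display)
    (T : measurableType d) (c : \bar R) (f : T -> R) :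
  measurable_fun setT f -> measurable [set w | (c < (f w)%:E)%E].
Proof.
move=> mf; case: c => [r| |].
- by under eq_set do rewrite lte_fin; exact: measurable_lt_fun.
- by rewrite (_ : [set w | _] = set0) // -subset0 => w /=.
- by rewrite (_ : [set w | _] = setT) // -subTset => w _ /=; rewrite ltNyr.
Qed.

Section Deviation.
Context (R : realType) (M : metricType R) (d d' : measure_display)
  (Xi : measurableType d) (P : probability Xi R)
  (Omega : measurableType d') (Pr : probability Omega R)
  (N : nat) (hN : (0 < N)%N) (xi : 'I_N -> {mfun Omega >-> Xi})
  (hxi : iid Pr P xi) (G : M -> Xi -> R) (hG : jointly_measurable G) (x0 : M)
  (L : Xi -> R) (hLmeas : measurable_fun setT L) (hL0 : forall z, 0 <= L z)
  (nu : R) (hnu : 0 <= nu)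
  (hL2 : (\int[P]_z (L z ^+ 2)%:E <= (nu ^+ 2)%:E)%E)
  (alpha : R)
  (hLip : {ae P, forall z : Xi, forall x x' : M,
               `|G x z - G x' z| <= L z * mdist x x' `^ alpha}).

(* [N] times the paper's (Ê - E)(G(x, .) - G(x_0, .)). *)
Definition dev (x : M) (w : Omega) : R :=
  \sum_(k < N) (G x (xi k w) - G x0 (xi k w)
                - fine (\int[P]_z (G x z - G x0 z)%:E)).

(** This quantifies over uncountably many points and may fail to be measurable; what is proved is
    that its complement is negligible. *)
Definition regular : set Omega := [set w | forall (k : 'I_N) x x',
  `|G x (xi k w) - G x' (xi k w)| <= L (xi k w) * mdist x x' `^ alpha].

Definition small_L : set Omega :=
  [set w | empE xi w (fun z => L z ^+ 2) <= 2 * nu ^+ 2].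

Let mG x : measurable_fun setT (G x).
Proof. exact: jointly_measurable_section. Qed.

Let mGB x y : measurable_fun setT (fun z => G x z - G y z).
Proof. exact: measurable_funB. Qed.

Lemma measurable_dev x : measurable_fun setT (dev x).
Proof.
apply: measurable_sum => k; apply: measurable_funB => //.
by apply: measurable_funB; exact: measurableT_comp.
Qed.

Lemma measurable_small_L : measurable small_L.
Proof.
rewrite -[small_L]setTI; apply: measurable_fun_le => //.
apply: measurable_funM => //; apply: measurable_sum => k.
by apply: measurable_funX; exact: measurableT_comp.
Qed.

Lemma negligible_not_regular : Pr.-negligible (~` regular).
Proof.
have : {ae Pr, forall w, forall (k : 'I_N) x x',
    `|G x (xi k w) - G x' (xi k w)| <= L (xi k w) * mdist x x' `^ alpha}.
  apply: filter_forall => k.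
  have law B : measurable B -> distribution Pr (xi k) B = P B by case: hxi => _; exact.
  exact: (@ae_distribution _ _ _ _ _ Pr P (xi k) (fun z => forall x x' : M,
    `|G x z - G x' z| <= L z * mdist x x' `^ alpha) law hLip).
by [].
Qed.

Lemma sqr_increment_le x y delta : mdist x y `^ alpha <= delta ->
  (\int[P]_z ((G x z - G y z) ^+ 2)%:E <= (delta ^+ 2 * nu ^+ 2)%:E)%E.
Proof.
move=> xy; have delta0 : 0 <= delta by apply: le_trans xy; exact: powR_ge0.
apply: (@le_trans _ _ (\int[P]_z ((delta * L z) ^+ 2)%:E)%E).
  apply: integral_sqr_ae_le => //; first exact: measurable_funM.
  apply: filterS hLip => z /(_ x y) /le_trans; apply.
  by rewrite mulrC ler_wpM2r.
under eq_integral => z _ do rewrite exprMn EFinM.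
rewrite ge0_integralZl_EFin //; last first.
- by rewrite sqr_ge0.
- by apply/measurable_EFinP; exact: measurable_funX.
- by move=> z _; rewrite lee_fin sqr_ge0.
by rewrite [leRHS]EFinM lee_wpmul2l // lee_fin sqr_ge0.
Qed.

Lemma integrable_increment x y : P.-integrable setT (EFin \o (fun z => G x z - G y z)).
Proof.
apply: integrable_of_sqr => //.
by apply: le_lt_trans (sqr_increment_le (lexx _)) _; rewrite ltry.
Qed.

Lemma devB x y w : dev x w - dev y w =
  \sum_(k < N) (G x (xi k w) - G y (xi k w) - fine (\int[P]_z (G x z - G y z)%:E)).
Proof.
rewrite /dev -sumrB; apply: eq_bigr => k _.
have -> : fine (\int[P]_z (G x z - G y z)%:E)%E =
   fine (\int[P]_z (G x z - G x0 z)%:E)%E - fine (\int[P]_z (G y z - G x0 z)%:E)%E.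
  have ix := integrable_increment x x0; have iy := integrable_increment y x0.
  rewrite -fineB ?integrable_fin_num // -integralB_EFin //.
  congr fine; apply: eq_integral => z _; rewrite -EFinB; congr EFin.
  by rewrite opprB addrA subrK.
by rewrite !opprB; ring.
Qed.

Lemma dev0 w : dev x0 w = 0.
Proof.
rewrite /dev big1 // => k _; rewrite subrr.
by under eq_integral => z _ do rewrite subrr; rewrite integral0 subr0.
Qed.

(** The expectations of increments are finite, so the extended absolute values are real and the
    factor 1/N comes out. *)
Lemma DeltaG_dev w :
  DeltaG P xi G x0 w = ereal_sup [set (N%:R^-1 * `|dev x w|)%:E | x in setT].
Proof.
rewrite /DeltaG; congr ereal_sup; apply/seteqP.
have E x : (`|(empE xi w (fun z => (G x z - G x0 z)%R))%:E
    - 'E_P[(fun z => (G x z - G x0 z)%R)]|)%E = (N%:R^-1 * `|dev x w|)%:E.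
  rewrite unlock -[X in (_ - X)%E]fineK ?integrable_fin_num //; last exact: integrable_increment.
  rewrite -EFinB abse_EFin; congr EFin.
  rewrite -[N%:R^-1]ger0_norm ?invr_ge0 // -normrM; congr `|_|.
  rewrite /empE /dev [X in _ = _ * X]sumrB sumr_const card_ord.
  rewrite -[fine _ *+ N]mulr_natl mulrBr mulKf //.
  by rewrite pnatr_eq0 -lt0n.
by split => _ [x _ <-]; exists x.
Qed.

(** On [regular] and [small_L] the squared increments sum to at most delta^2 times the sum of L^2,
    hence to at most 2 N v with v = delta^2 nu^2. This is the event of [self_normalized_tail2]. *)
Lemma dev_tail x y delta K : 0 <= K -> mdist x y `^ alpha <= delta ->
  (mu_ext Pr ((regular `&` small_L) `&`
     [set w | (K * (Num.sqrt N%:R * nu) * delta < `|dev x w - dev y w|)%R])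
   <= (2 * expR (- (3 / 8 * K ^+ 2)))%:E)%E.
Proof.
move=> K0 xy; have delta0 : 0 <= delta by apply: le_trans xy; exact: powR_ge0.
have v0 : 0 <= delta ^+ 2 * nu ^+ 2 by rewrite mulr_ge0 ?sqr_ge0.
have [mB PB] := self_normalized_tail2 hN hxi (mGB x y) v0 (sqr_increment_le xy) K0.
apply: le_trans PB; rewrite -measurable_mu_extE //.
apply: le_mu_ext => w [[rw sw] /=].
have -> : Num.sqrt (N%:R * (delta ^+ 2 * nu ^+ 2)) = Num.sqrt N%:R * nu * delta.
  rewrite sqrtrM // sqrtrM ?sqr_ge0 // !sqrtr_sqr !ger0_norm //.
  by rewrite mulrCA mulrC.
rewrite devB => devK; split => /=; last by move: devK; rewrite !mulrA.
apply: (@le_trans _ _ (delta ^+ 2 * \sum_(k < N) L (xi k w) ^+ 2)).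
  rewrite mulr_sumr; apply: ler_sum => k _.
  rewrite -real_normK ?num_real // -exprMn lerXn2r ?nnegrE ?mulr_ge0 //.
  by apply: le_trans (rw k x y) _; rewrite mulrC ler_wpM2r.
have -> : 2 * (N%:R * (delta ^+ 2 * nu ^+ 2)) = delta ^+ 2 * (N%:R * (2 * nu ^+ 2)) by ring.
by rewrite ler_wpM2l ?sqr_ge0 // -ler_pdivrMl ?ltr0n //; exact: sw.
Qed.

Lemma dev_lipschitz w : regular w -> exists C, 0 <= C /\ forall x y,
  `|dev x w - dev y w| <= C * mdist x y `^ alpha.
Proof.
move=> rw.
(* The first part handles the sample sum; the second handles the means, since L <= 1 + L^2 gives E L
   <= 1 + nu^2. *)
exists (\sum_(k < N) L (xi k w) + N%:R * (1 + nu ^+ 2)).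
split; first by rewrite addr_ge0 ?sumr_ge0 // mulr_ge0 // addr_ge0 ?sqr_ge0.
move=> x y; rewrite devB sumrB sumr_const card_ord -[fine _ *+ N]mulr_natl.
apply: le_trans (ler_normB _ _) _; rewrite mulrDl; apply: lerD.
  apply: le_trans (ler_norm_sum _ _ _) _; rewrite mulr_suml.
  by apply: ler_sum => k _; exact: rw.
rewrite normrM ger0_norm // -mulrA ler_wpM2l //.
set delta := _ `^ alpha.
have delta0 : 0 <= delta by exact: powR_ge0.
have iY := integrable_increment x y.
rewrite -lee_fin -abse_EFin fineK ?integrable_fin_num //.
apply: le_trans (le_abse_integral _ _ _) _ => //; first by case/integrableP : iY.
have mL2 : measurable_fun setT (EFin \o (fun z => L z ^+ 2)).
  by apply/measurable_EFinP; exact: measurable_funX.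
apply: (@le_trans _ _ (\int[P]_z (delta%:E * (1%:E + (L z ^+ 2)%:E)))%E).
  apply: ae_ge0_le_integral => //.
  - by case/integrableP : iY => mY _; exact: measurableT_comp.
  - by move=> z _; rewrite -EFinD -EFinM lee_fin mulr_ge0 // addr_ge0 ?sqr_ge0.
  - by apply: emeasurable_funM => //; exact: emeasurable_funD.
  apply: filterS hLip => z /(_ x y) Lz _; rewrite -EFinD -EFinM lee_fin.
  apply: le_trans Lz _; rewrite mulrC ler_wpM2l //.
  by have := hL0 z; nra.
rewrite ge0_integralZl_EFin //; last first.
- exact: emeasurable_funD.
- by move=> z _; rewrite -EFinD lee_fin addr_ge0 ?sqr_ge0.
rewrite ge0_integralD //; last by move=> z _; rewrite lee_fin sqr_ge0.
rewrite (integral_cst P measurableT 1%:E) /= probability_setT mule1 mulrC EFinM EFinD.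
by rewrite lee_wpmul2l ?lee_fin // leeD2l.
Qed.

(** On [regular] the deviation is Hölder continuous in x, so a strict lower bound on the supremum is
    already witnessed along a dense sequence. The event thus agrees with a measurable set outside a
    null set. *)
Lemma completed_algebra_DeltaG (c : \bar R) :
  0 < alpha -> totally_bounded_space M ->
  completed_algebra_gen Pr
    [set w | small_L w /\ (c < DeltaG P xi G x0 w)%E].
Proof.
move=> a0 tb; have [q qdense] := totally_bounded_dense_seq x0 tb.
set E := [set w | _].
have [B [mB PB regB]] := negligible_not_regular.
pose A := small_L `&` \bigcup_n [set w | (c < (N%:R^-1 * `|dev (q n) w|)%:E)%E].
have mA : measurable A.
  apply: measurableI; first exact: measurable_small_L.
  apply: bigcupT_measurable => n.
  have mdev : measurable_fun setT (fun w => N%:R^-1 * `|dev (q n) w|).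
    apply: measurable_funM => //; apply: measurableT_comp => //.
    exact: measurable_dev.
  exact: measurable_lt_EFin.
have AE w : regular w -> A w <-> E w.
  move=> rw; rewrite /A /E /= DeltaG_dev; split => -[sw H]; split => //.
    have [n _ cn] := H; apply: lt_le_trans cn _.
    by apply: ereal_sup_ubound; exists (q n).
  have [_ [x _ <-] cx] := ereal_sup_gt H.
  have [C [C0 CP]] := dev_lipschitz rw.
  (* A real level between [c] and the value at x, needed because [c] may be infinite. *)
  have [r cr rx] : exists2 r : R, (c <= r%:E)%E & r < N%:R^-1 * `|dev x w|.
    move: cx; case: (c) => [r| |] //= cx; first by exists r => //; rewrite -lte_fin.
    by exists (N%:R^-1 * `|dev x w| - 1); rewrite ?leNye // ltrBlDr ltrDl.
  set gap := N%:R^-1 * `|dev x w| - r.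
  have gap0 : 0 < gap by rewrite subr_gt0.
  (* Then C eta < gap, and the denominator is positive even when C = 0. *)
  pose eta := gap / (C + 1).
  have C1 : 0 < C + 1 by rewrite ltr_wpDl.
  have eta0 : 0 < eta by rewrite divr_gt0.
  have [n nq] := qdense x (eta `^ alpha^-1) (powR_gt0 _ eta0).
  exists n => //=; apply: le_lt_trans cr _; rewrite lte_fin.
  have close : mdist x (q n) `^ alpha <= eta.
    apply: (@le_trans _ _ ((eta `^ alpha^-1) `^ alpha)).
      by apply: ge0_ler_powR; rewrite ?nnegrE ?mdist_ge0 ?powR_ge0 ?ltW.
    by rewrite -powRrM mulVf ?gt_eqF // powRr1 // ltW.
  have : `|dev x w| - `|dev (q n) w| < gap.
    apply: le_lt_trans (lerB_dist _ _) _; apply: le_lt_trans (CP _ _) _.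
    apply: (@le_lt_trans _ _ (C * eta)); first by rewrite ler_wpM2l.
    rewrite /eta mulrCA gtr_pMr // ltr_pdivrMr // mul1r ltrDl //.
  have N1 : N%:R^-1 <= 1 :> R by rewrite invf_le1 ?ltr0n // ler1n.
  have Ninv0 : 0 < N%:R^-1 :> R by rewrite invr_gt0 ltr0n.
  rewrite /gap => H1.
  rewrite -subr_gt0.
  have : N%:R^-1 * (`|dev x w| - `|dev (q n) w|) < N%:R^-1 * `|dev x w| - r.
    have [le0|gt0] := leP (`|dev x w| - `|dev (q n) w|) 0.
      by apply: le_lt_trans gap0; rewrite pmulr_rle0.
    by apply: le_lt_trans H1; rewrite ler_piMl // ltW.
  by rewrite mulrBr; lra.
(* The event is split into a measurable part outside the null set [B] and a subset of [B]. *)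
exists (A `\` B); first exact: measurableD.
exists (E `&` B); first by exists B; split => // w [].
apply/seteqP; split => [w [[Aw nBw]|[]]//|w Ew].
  by apply/AE => //; apply: contrapT => nr; exact/nBw/regB.
have [Bw|nBw] := pselect (B w); first by right.
left; split => //; apply/AE => //.
by apply: contrapT => nr; exact/nBw/regB.
Qed.

(** If nu = 0, [small_L] forces L to vanish at every sample point; if all distances vanish,
    [dev_lipschitz] concludes. In both cases a nonnegative threshold cannot be exceeded. *)
Lemma DeltaG_eq0 w : regular w -> small_L w ->
  nu = 0 \/ (forall x, mdist x x0 `^ alpha = 0) ->
  DeltaG P xi G x0 w = 0%E.
Proof.
move=> rw sw degenerate.
suff H x : dev x w = 0.
  rewrite DeltaG_dev (_ : [set _ | x in _] = [set 0%E]) ?ereal_sup1 //.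
  apply/seteqP; split => [_ [x _ <-]|_ ->] /=; first by rewrite H normr0 mulr0.
  by exists x0 => //; rewrite H normr0 mulr0.
case: degenerate => [nu0|M0]; last first.
  have [C [_ CP]] := dev_lipschitz rw.
  apply/eqP; rewrite -normr_le0; move: (CP x x0).
  by rewrite dev0 subr0 M0 mulr0.
have L0 k : L (xi k w) = 0.
  apply/eqP; rewrite -sqrf_eq0 eq_le sqr_ge0 andbT.
  have : \sum_(k < N) L (xi k w) ^+ 2 <= 0.
    have := sw; rewrite /small_L /empE /= nu0 expr0n /= mulr0.
    by rewrite pmulr_rle0 // invr_gt0 ltr0n.
  apply: le_trans; rewrite (bigD1 k) //= lerDl.
  by apply: sumr_ge0 => *; exact: sqr_ge0.
rewrite /dev big1 // => k _.
rewrite integral_eq0_of_sqr ?subr0 //; last first.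
  have := sqr_increment_le (lexx (mdist x x0 `^ alpha)).
  by rewrite nu0 expr0n /= mulr0.
apply/eqP; rewrite -normr_le0; apply: le_trans (rw k x x0) _.
by rewrite L0 mul0r.
Qed.

End Deviation.

(** * Assembly of the deviation bound *)

Lemma mu_ext_negligible (R : realType) (d : measure_display)
    (T : measurableType d) (mu : {measure set T -> \bar R}) (A : set T) :
  mu.-negligible A -> (mu_ext mu A = 0)%E.
Proof.
move=> [B [mB B0 AB]]; apply/eqP; rewrite eq_le outer_measure_ge0 andbT.
by apply: le_trans (le_mu_ext mu AB) _; rewrite measurable_mu_extE ?B0.
Qed.

(** A finite bound on the sum of nonnegative terms makes every term finite, so the extended
    diameters become real radii; the weights 2^(j/2) are powers of sqrt 2. *)
Lemma admissible_nets (R : realType) (M : metricType R) (alpha s : R) (x0 : M)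
    (F : nat -> set (set M)) :
  0 <= alpha -> admissible F ->
  (\sum_(0 <= j <oo) (2 `^ (j%:R / 2))%:E * poweR (diam_cells (F j)) alpha
     <= s%:E)%E ->
  exists (p : nat -> nat -> M) (e : nat -> R),
    [/\ forall j, 0 <= e j,
        forall j x, (0 < j)%N -> exists2 k, (k < 2 ^ 2 ^ j)%N &
          mdist x (p j k) `^ alpha <= e j
      & forall m, \sum_(0 <= j < m) Num.sqrt 2 ^+ j * e j <= s].
Proof.
move=> a0 [partF F0 Fcard] sum_le.
pose u j := ((2 `^ (j%:R / 2))%:E * poweR (diam_cells (F j)) alpha)%E.
have u0 j : (0 <= u j)%E.
  by apply: mule_ge0; rewrite ?lee_fin ?powR_ge0 ?poweR_ge0.
have u_le m : (\sum_(0 <= j < m) u j <= s%:E)%E.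
  by apply: le_trans sum_le; apply: nneseries_lim_ge.
have u_lty j : (u j < +oo)%E.
  apply: le_lt_trans (ltry s); apply: le_trans (u_le j.+1).
  by rewrite big_nat_recr //= leeDr // sume_ge0.
have pow_fin j : poweR (diam_cells (F j)) alpha \is a fin_num.
  rewrite ge0_fin_numE ?poweR_ge0 // ltey; apply/negP => /eqP Dy.
  by have := u_lty j; rewrite /u Dy gt0_muley ?ltxx // lte_fin powR_gt0.
have sqrtE j : 2 `^ (j%:R / 2) = Num.sqrt 2 ^+ j :> R.
  by rewrite mulrC powRrM powR12_sqrt // powR_mulrn ?sqrtr_ge0.
have /choice[p pP] j : exists p : nat -> M, (0 < j)%N ->
    forall x, exists2 k, (k < 2 ^ 2 ^ j)%N &
      mdist x (p k) `^ alpha <= fine (poweR (diam_cells (F j)) alpha).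
  have [j0|j_eq0] := posnP j; first by exists (fun=> x0); rewrite j0.
  have [p pP] := partition_net x0 a0 (partF j) (Fcard j j_eq0).
  exists p => _ x; have [k kj xk] := pP x; exists k => //.
  by rewrite -lee_fin fineK.
exists p, (fun j => fine (poweR (diam_cells (F j)) alpha)); split.
- by move=> j; rewrite fine_ge0 // poweR_ge0.
- by move=> j x j0; exact: pP.
- move=> m; rewrite -lee_fin -sumEFin; apply: le_trans (u_le m).
  by rewrite le_eqVlt; apply/orP; left; apply/eqP; apply: eq_bigr => j _;
    rewrite /u EFinM fineK // sqrtE.
Qed.

Theorem theorem4 (R : realType) (M : metricType R)
    (hM : totally_bounded_space M)
    (d : measure_display) (Xi : measurableType d) (P : probability Xi R)
    (d' : measure_display) (Omega : measurableType d')
    (Pr : probability Omega R)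
    (N : nat) (hN : (0 < N)%N) (xi : 'I_N -> {mfun Omega >-> Xi})
    (hxi : iid Pr P xi)
    (G : M -> Xi -> R) (hG : jointly_measurable G)
    (x0 : M) (hx0 : ('E_P[fun z => `|G x0 z|%R] < +oo)%E)
    (L : Xi -> R) (hLmeas : measurable_fun setT L) (hL0 : forall z, 0 <= L z)
    (nu : R) (hnu : 0 <= nu)
    (hL2 : ('E_P[fun z => (L z ^+ 2)%R] <= (nu ^+ 2)%:E)%E)
    (alpha : R) (halpha0 : 0 < alpha) (halpha1 : alpha <= 1)
    (hLip : {ae P, forall z : Xi, forall x x' : M,
               `|G x z - G x' z| <= L z * mdist x x' `^ alpha})
    (rho : R) (hrho0 : 0 <= rho) (hrho1 : rho <= 1)
    (hrho : (Pr [set w | 2 * nu ^+ 2 < empE xi w (fun z => L z ^+ 2)]%R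
             <= rho%:E)%E)
    (t : R) (ht : 0 <= t) :
  completed_prob_le Pr
    [set w | empE xi w (fun z => L z ^+ 2) <= 2 * nu ^+ 2 /\
       (nu%:E * ((4 * Num.sqrt 3)%:E * gamma2 alpha M
                 + (6 * Num.sqrt 3)%:E * poweR (diam [set: M]) alpha
                   * (Num.sqrt (1 + t))%:E)
              * ((Num.sqrt N%:R)^-1)%:E
        < DeltaG P xi G x0 w)%E]
    (expR (- t))%:E.
Proof.
rewrite unlock in hL2.
set c := (nu%:E * _ * _)%E.
split.
  exact: (completed_algebra_DeltaG hN hxi hG x0 hLmeas hL0 hL2 hLip c halpha0 hM).
set E := [set w | _].
set reg := regular xi G L alpha.
have nreg : (mu_ext Pr (~` reg) = 0)%E.
  by apply: mu_ext_negligible; exact: (negligible_not_regular hxi hLip).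
have t1 : 0 < Num.sqrt (1 + t) by rewrite sqrtr_gt0; lra.
have sN : 0 < Num.sqrt N%:R :> R by rewrite sqrtr_gt0 ltr0n.
(* The part of [E] outside [reg] has outer measure 0, so subadditivity discards it. *)
suff main : (mu_ext Pr (reg `&` E) <= (expR (- t))%:E)%E.
  apply: le_trans (le_outer_measureIC (mu_ext Pr) reg E) _.
  rewrite -[leRHS]adde0; apply: leeD; first by rewrite setIC.
  by rewrite -nreg; apply: le_mu_ext => w [].
have triv : reg `&` E = set0 -> (mu_ext Pr (reg `&` E) <= (expR (- t))%:E)%E.
  by move=> ->; rewrite outer_measure0 lee_fin expR_ge0.
have Dgamma := diam_le_gamma2 x0 (ltW halpha0).
have D0 : (0 <= poweR (diam [set: M]) alpha)%E by exact: poweR_ge0.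
have g0 := le_trans D0 Dgamma.
have c0 : (0 <= c)%E.
  rewrite /c !mule_ge0 ?lee_fin ?invr_ge0 ?(ltW sN) // adde_ge0 // !mule_ge0 //;
  by rewrite lee_fin ?mulr_ge0 ?sqrtr_ge0.
have [nu_eq0|nu_neq0] := eqVneq nu 0.
  apply: triv; rewrite -subset0 => w [rw [sw]].
  rewrite (DeltaG_eq0 hN hG hLmeas hL0 hL2 hLip rw sw) ?ltNge ?c0 //.
  by left.
have nu0 : 0 < nu by rewrite lt_neqAle eq_sym nu_neq0.
(* An infinite [gamma2] makes the threshold infinite, as nu > 0, and the event empty. *)
move: g0 Dgamma; case gE : (gamma2 alpha M) => [g| |] // g0 Dgamma; last first.
  apply: triv; rewrite -subset0 => w [rw [sw]].
  rewrite /c gE gt0_muley ?lte_fin ?mulr_gt0 ?sqrtr_gt0 //.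
  rewrite addye; last first.
    suff : (0 <= (6 * Num.sqrt 3)%:E * poweR (diam [set: M]) alpha
        * (Num.sqrt (1 + t))%:E)%E by case: (_ * _)%E.
    by rewrite !mule_ge0 // lee_fin ?mulr_ge0 ?sqrtr_ge0.
  by rewrite gt0_muley ?lte_fin // gt0_mulye ?lte_fin ?invr_gt0 // ltNge leey.
have Dfin : poweR (diam [set: M]) alpha \is a fin_num.
  by rewrite ge0_fin_numE // (le_lt_trans Dgamma) // ltry.
set D := fine (poweR (diam [set: M]) alpha).
have DE : poweR (diam [set: M]) alpha = D%:E by rewrite fineK.
have D_ge0 : 0 <= D by rewrite -lee_fin -DE.
have mdistD (x y : M) : mdist x y `^ alpha <= D.
  rewrite -lee_fin -DE -poweR_EFin; apply: gt0_ler_poweR; rewrite ?(ltW halpha0) //.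
  - by rewrite in_itv /= lee_fin mdist_ge0 leey.
  - by rewrite in_itv /= leey diam_ge0.
  - by apply: ereal_sup_ubound; exists x => //; exists y.
rewrite lee_fin in g0.
rewrite DE lee_fin in Dgamma.
(* If [gamma2] vanishes, no sequence of sum below [9/8 gamma2] exists, but then
   [M] is a single point. *)
have [g_eq0|g_neq0] := eqVneq g 0.
  apply: triv; rewrite -subset0 => w [rw [sw]].
  rewrite (DeltaG_eq0 hN hG hLmeas hL0 hL2 hLip rw sw) ?ltNge ?c0 //.
  right => x; apply/eqP; rewrite eq_le powR_ge0 andbT.
  by apply: le_trans (mdistD _ _) _; rewrite -g_eq0.
have g_gt0 : 0 < g by rewrite lt_neqAle eq_sym g_neq0.
have [_ [F admF <-] Fg] : exists2 S, [set (\sum_(0 <= j <oo)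
      (2 `^ (j%:R / 2))%:E * poweR (diam_cells (F j)) alpha)%E
      | F in @admissible R M] S & (S < (9 / 8 * g)%:E)%E.
  apply: ereal_inf_lt; rewrite -/(gamma2 alpha M) gE lte_fin; lra.
have [p [e [e0 net sum_le]]] := admissible_nets x0 (ltW halpha0) admF (ltW Fg).
have sigma0 : 0 <= Num.sqrt N%:R * nu by rewrite mulr_ge0 ?ltW.
have := @generic_chaining R M Omega (mu_ext Pr) (dev P xi G x0)
  (reg `&` small_L xi L nu) alpha (Num.sqrt N%:R * nu) t D (9 / 8 * g) x0 p e
  halpha0 halpha1 sigma0 ht.
move=> /(_ _ _ _ e0 net sum_le); move=> chain.
apply: le_trans (chain _ _ _).
- apply: le_mu_ext => w [rw [sw cw]]; split; first by split.
  move: cw; rewrite (DeltaG_dev hN xi hG x0 hLmeas hL0 hL2 hLip) => /ereal_sup_gt[_ [x _ <-] cx].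
  exists x; rewrite (dev0 P xi G x0 w) subr0.
  move: cx; rewrite /c gE DE -!EFinM lte_fin => cx.
  rewrite ltr_pdivlMl ?ltr0n // in cx.
  apply: le_lt_trans cx.
  (* Passing from the mean to the sum [dev] multiplies the threshold by N, which leaves the scale
     sqrt N nu used in the chaining. *)
  have NE (u : R) : N%:R * (nu * u / Num.sqrt N%:R) = Num.sqrt N%:R * nu * u.
    have : N%:R = Num.sqrt N%:R ^+ 2 :> R by rewrite sqr_sqrtr.
    move: (Num.sqrt N%:R) sN => q q0 ->; field.
    by rewrite gt_eqF.
  rewrite NE.
  rewrite ler_wpM2l // lerD2r (_ : 6 = 2 * 3 :> R); last by rewrite -natrM.
  rewrite sqrtrM //.
  (* This crude bound suffices: the chaining constant is sqrt 3 times 9/8 (sqrt 2 + 2), and 9/8 (3/2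
     + 2) = 63/16 < 4. *)
  have s2 : Num.sqrt 2 <= 3 / 2 :> R.
    rewrite -(@ler_pXn2r _ 2) ?nnegrE ?sqrtr_ge0 // sqr_sqrtr //; lra.
  have -> : Num.sqrt 2 * Num.sqrt 3 * (1 + Num.sqrt 2) * (9 / 8 * g) =
    Num.sqrt 3 * g * (9 / 8 * (Num.sqrt 2 + Num.sqrt 2 ^+ 2)) by ring.
  rewrite sqr_sqrtr // (_ : 4 * Num.sqrt 3 * g = Num.sqrt 3 * g * 4); last by ring.
  by rewrite ler_wpM2l ?mulr_ge0 ?sqrtr_ge0 //; lra.
- by move=> x y delta K K0 xy; exact: (dev_tail hN hxi hG x0 hLmeas hL0 hnu hL2 hLip).
- by move=> w [rw _]; have [C [_ CP]] := dev_lipschitz hG x0 hLmeas hL0 hL2 hLip rw; exists C.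
- by move=> x.
Qed.
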